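(* Let $\mathcal{A}\in\mathbb{C}^{n\times n}$, $\mathcal{B}\in\mathbb{C}^{n\times m_1}$, $\mathcal{C}\in\mathbb{C}^{m_2\times n}$ be such that $\varphi(z)=\mathcal{C}(zI_n-\mathcal{A})^{-1}\mathcal{B}$ is a minimal realization of a strictly proper rational $m_2\times m_1$ matrix function, and let $\{\alpha,S_0,\vartheta_1,\vartheta_2\}$ be the quadruple recovered from $\{\mathcal{A},\mathcal{B},\mathcal{C}\}$ (by the recovery procedure described in the context). This recovery is stable, that is, for every $\varepsilon>0$ there is a $\delta>0$ such that for every triple $\{\widetilde{\mathcal{A}},\widetilde{\mathcal{B}},\widetilde{\mathcal{C}}\}$ of matrices of the same respective sizes, giving a minimal realization $\widetilde\varphi(z)=\widetilde{\mathcal{C}}(zI_n-\widetilde{\mathcal{A}})^{-1}\widetilde{\mathcal{B}}$, the inequality $$\|\mathcal{A}-\widetilde{\mathcal{A}}\|+\|\mathcal{B}-\widetilde{\mathcal{B}}\|+\|\mathcal{C}-\widetilde{\mathcal{C}}\|<\delta$$ yields the inequality $$\|\alpha-\widetilde\alpha\|+\|S_0-\widetilde S_0\|+\|\vartheta_1-\widetilde\vartheta_1\|+\|\vartheta_2-\widetilde\vartheta_2\|<\varepsilon,$$ where $\{\widetilde\alpha,\widetilde S_0,\widetilde\vartheta_1,\widetilde\vartheta_2\}$ is the quadruple recovered from $\{\widetilde{\mathcal{A}},\widetilde{\mathcal{B}},\widetilde{\mathcal{C}}\}$ by the same procedure.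
   Context: $\|\cdot\|$ is the $\ell^2$-induced matrix norm. $X>0$ means that $X$ is Hermitian with all eigenvalues positive. A rational matrix function is strictly proper if it tends to zero at infinity. A realization $\varphi(z)=\mathcal{C}(zI_n-\mathcal{A})^{-1}\mathcal{B}$ is minimal if $n$ is minimal among all possible realizations of $\varphi$; equivalently, $\mathrm{span}\bigcup_{k=0}^{n-1}\mathrm{Im}(\mathcal{A}^k\mathcal{B})=\mathbb{C}^n$ (controllability of $\{\mathcal{A},\mathcal{B}\}$) and $\mathrm{span}\bigcup_{k=0}^{n-1}\mathrm{Im}((\mathcal{A}^* )^k\mathcal{C}^* )=\mathbb{C}^n$ (observability of $\{\mathcal{C},\mathcal{A}\}$). Recovery procedure: given a minimal realization, let $X>0$ be the positive solution (it exists and is unique, by known results) of the Riccati equation $$X\mathcal{C}^*\mathcal{C}X+\mathrm{i}(\mathcal{A}X-X\mathcal{A}^* )-\mathcal{B}\mathcal{B}^*=0,$$ and put $$\alpha=\mathcal{A}+\mathrm{i}\,\mathcal{B}\mathcal{B}^*X^{-1},\quad S_0=X,\quad \vartheta_1=\mathcal{B},\quad \vartheta_2=\mathrm{i}X\mathcal{C}^*.$$ *)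

(* Defs.v *)
From HB Require Import structures.
From mathcomp Require Import all_boot all_order all_algebra.
From mathcomp Require Import spectral.
From mathcomp Require Import complex.
From mathcomp Require Import classical_sets reals.

Set Implicit Arguments.
Unset Strict Implicit.
Unset Printing Implicit Defensive.

Import Order.TTheory GRing.Theory Num.Theory.

Local Open Scope ring_scope.
Local Open Scope complex_scope.
Local Open Scope sesquilinear_scope.
Local Open Scope classical_set_scope.

(* [M ^t*] is the conjugate transpose of [M]. *)

Definition l2norm (R : realType) (n : nat) (x : 'cV[R[i]]_n) : R :=
  Num.sqrt (\sum_(k < n) Normc.normc (x k 0) ^+ 2).

(* Taking the closed unit ball, rather than the unit sphere, gives the value 0
   when one of the dimensions is 0. *)
Definition opnorm (R : realType) (m n : nat) (A : 'M[R[i]]_(m, n)) : R :=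
  sup [set l2norm (A *m x) | x in [set x : 'cV[R[i]]_n | l2norm x <= 1]].

(* In [R[i]], [0 < a] holds exactly when [a] is real and positive. *)
Definition posdefmx (R : realType) (n : nat) (X : 'M[R[i]]_n) : Prop :=
  X \is hermsymmx /\ (forall a : R[i], eigenvalue X a -> 0 < a).

(* Rational functions are elements of the fraction field of [{poly R[i]}]. *)
Definition ratfun (R : realType) : fieldType := {fraction {poly R[i]}}.

Definition polyfun (R : realType) (p : {poly R[i]}) : ratfun R :=
  FracField.tofrac p.

Definition strictly_proper (R : realType) (m n : nat)
    (phi : 'M[ratfun R]_(m, n)) : Prop :=
  forall i j, exists p q : {poly R[i]},
    [/\ q != 0,
        phi i j = polyfun p / polyfun q &
        forall e : R, 0 < e -> exists M : R, forall z : R[i],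
          M < Normc.normc z -> Normc.normc (p.[z] / q.[z]) < e].

(* The rational matrix function C (z I_n - A)^-1 B; [char_poly_mx A] is
   z I_n - A, which is always invertible over the rational functions. *)
Definition transfer (R : realType) (n m1 m2 : nat) (A : 'M[R[i]]_n)
    (B : 'M[R[i]]_(n, m1)) (C : 'M[R[i]]_(m2, n)) : 'M[ratfun R]_(m2, m1) :=
  map_mx (fun c => polyfun c%:P) C
    *m invmx (map_mx (@polyfun R) (char_poly_mx A))
    *m map_mx (fun c => polyfun c%:P) B.

Definition minimal_realization (R : realType) (n m1 m2 : nat)
    (phi : 'M[ratfun R]_(m2, m1)) (A : 'M[R[i]]_n)
    (B : 'M[R[i]]_(n, m1)) (C : 'M[R[i]]_(m2, n)) : Prop :=
  phi = transfer A B C /\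
  (forall (k : nat) (A' : 'M[R[i]]_k) (B' : 'M[R[i]]_(k, m1))
      (C' : 'M[R[i]]_(m2, k)), phi = transfer A' B' C' -> (n <= k)%N).

Definition riccati (R : realType) (n m1 m2 : nat) (A : 'M[R[i]]_n)
    (B : 'M[R[i]]_(n, m1)) (C : 'M[R[i]]_(m2, n)) (X : 'M[R[i]]_n) : Prop :=
  X *m C ^t* *m C *m X + 'i *: (A *m X - X *m A ^t*) - B *m B ^t* = 0.

(* The recovery procedure is a relation because it goes through the positive
   solution X, which exists and is unique when the realization is minimal. *)
Definition recovered (R : realType) (n m1 m2 : nat) (A : 'M[R[i]]_n)
    (B : 'M[R[i]]_(n, m1)) (C : 'M[R[i]]_(m2, n))
    (alpha S0 : 'M[R[i]]_n) (theta1 : 'M[R[i]]_(n, m1))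
    (theta2 : 'M[R[i]]_(n, m2)) : Prop :=
  exists X : 'M[R[i]]_n,
    [/\ posdefmx X /\ riccati A B C X,
        alpha = A + 'i *: (B *m B ^t* *m invmx X),
        S0 = X,
        theta1 = B &
        theta2 = 'i *: (X *m C ^t*)].

(* Main.v *)
(** Write [N = - i A].  The Riccati equation becomes the filtering equation
    [N X + X N^* - X C^* C X + B B^* = 0], whose positive solution makes
    [K = N - X C^* C] stable, so there is a positive definite [Q] with
    [K Q + Q K^* = -1].  For nearby data the suboptimal gain [X C^*] is still
    stabilizing, with the same certificate [Q], and comparing the solution [X']
    of the perturbed equation with it gives [X' <= X + c d], [d] being the size
    of the perturbation and [c] a constant independent of [X'].  The inverses
    solve the dual equation, in which [A^*], [C^*], [B^*] replace [A], [B],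
    [C], hence also [X'^-1 <= X^-1 + c d].  The two one-sided bounds together
    give a Lipschitz estimate for [X] and [X^-1].

    All positivity statements rest on one remark: if [X > 0], [D] is Hermitian
    and not [>= 0], then [X + t D] is singular for some [t > 0], and a kernel
    vector [v] of a Hermitian [Z] annihilates the form of [K Z + Z K^*].
    Controllability and observability enter as the absence of eigenvectors in
    the kernel, which follows from minimality by restricting the realization to
    a hyperplane. *)
Require Import Defs.
From mathcomp Require Import all_boot all_order all_algebra.
From mathcomp Require Import spectral sesquilinear.
From mathcomp Require Import complex classical_sets reals.
From mathcomp Require Import ring.

Set Implicit Arguments.
Unset Strict Implicit.
Unset Printing Implicit Defensive.

Import Order.TTheory GRing.Theory Num.Theory.

Local Open Scope ring_scope.
Local Open Scope sesquilinear_scope.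

(** * Algebra of the conjugate transpose *)

Section Adjoint.
Variable C : numClosedFieldType.

Lemma adjmxM m n p (A : 'M[C]_(m, n)) (B : 'M_(n, p)) :
  (A *m B) ^t* = B ^t* *m A ^t*.
Proof. by rewrite trmx_mul map_mxM. Qed.

Lemma adjmxD m n (A B : 'M[C]_(m, n)) : (A + B) ^t* = A ^t* + B ^t*.
Proof. by rewrite linearD map_mxD. Qed.

Lemma adjmxN m n (A : 'M[C]_(m, n)) : (- A) ^t* = - A ^t*.
Proof. by rewrite linearN map_mxN. Qed.

Lemma adjmxZ m n a (A : 'M[C]_(m, n)) : (a *: A) ^t* = a^* *: A ^t*.
Proof. by rewrite linearZ map_mxZ. Qed.

Lemma adjmx1 n : (1%:M : 'M[C]_n) ^t* = 1%:M.
Proof. by rewrite trmx1 map_mx1. Qed.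

Lemma adjmx_inv n (A : 'M[C]_n) : (invmx A) ^t* = invmx (A ^t*).
Proof. by rewrite trmx_inv map_invmx. Qed.

Lemma adjmx_diag_real n (d : 'rV[C]_n) :
  d \is a mxOver Num.real -> (diag_mx d) ^t* = diag_mx d.
Proof.
move=> /mxOverP dr; apply/matrixP => i j; rewrite !mxE rmorphMn /=.
by rewrite eq_sym (CrealP (dr _ _)); case: eqP => [->|].
Qed.
End Adjoint.

Definition adjmxE :=
  (adjmxM, adjmxD, adjmxN, adjmxZ, adjmx1, conjCi, @trmxCK).

(** * Proving matrix identities by expansion into entries *)

Section MatrixEntries.
Variable C : comPzRingType.
Lemma mxaddE m n (A B : 'M[C]_(m, n)) i j : (A + B) i j = A i j + B i j.
Proof. by rewrite mxE. Qed.
Lemma mxoppE m n (A : 'M[C]_(m, n)) i j : (- A) i j = - A i j.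
Proof. by rewrite mxE. Qed.
Lemma mxscaleE m n a (A : 'M[C]_(m, n)) i j : (a *: A) i j = a * A i j.
Proof. by rewrite mxE. Qed.
Lemma mxzeroE m n i j : (0 : 'M[C]_(m, n)) i j = 0.
Proof. by rewrite mxE. Qed.
End MatrixEntries.

Definition mx_entryE := (mxaddE, mxoppE, mxscaleE, mxzeroE).

(** Matrix products do not commute: they are expanded into left-associated monomials, whose entries
    [ring] then treats as atoms. *)
Ltac mxexpand := rewrite ?(mulmxDl, mulmxDr, mulmxBl, mulmxBr, mulNmx, mulmxN,
  =^~ scalemxAl, =^~ scalemxAr, mul1mx, mulmx1, mulmxA, mul0mx, mulmx0).
Ltac mxring := mxexpand; apply/matrixP => ? ?; rewrite ?mx_entryE; ring.

(** * Hermitian forms and positivity *)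

Section HermitianForms.
Variable C : numClosedFieldType.

(** Vectors are rows, to match left eigenvectors and [kermx]. In the order of [C], [0 <= z] includes
    that [z] is real. *)
Definition qform n (Z : 'M[C]_n) (v : 'rV[C]_n) : C := (v *m Z *m v ^t*) 0 0.

Definition psd n (Z : 'M[C]_n) := forall v, 0 <= qform Z v.

Definition posdef n (Z : 'M[C]_n) :=
  Z ^t* = Z /\ forall v, v != 0 -> 0 < qform Z v.

Lemma qformD n (Z Y : 'M[C]_n) v : qform (Z + Y) v = qform Z v + qform Y v.
Proof. by rewrite /qform mulmxDr mulmxDl mxE. Qed.

Lemma qformN n (Z : 'M[C]_n) v : qform (- Z) v = - qform Z v.
Proof. by rewrite /qform mulmxN mulNmx mxE. Qed.

Lemma qformZ n a (Z : 'M[C]_n) v : qform (a *: Z) v = a * qform Z v.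
Proof. by rewrite /qform -scalemxAr -scalemxAl mxE. Qed.

Lemma qform_diag n (d v : 'rV[C]_n) :
  qform (diag_mx d) v = \sum_i d 0 i * `|v 0 i| ^+ 2.
Proof.
rewrite /qform mul_mx_diag mxE; apply: eq_bigr => i _.
by rewrite !mxE normCK; ring.
Qed.

Lemma qform_congr n k (S : 'M[C]_(k, n)) (M : 'M_k) v :
  qform (S ^t* *m M *m S) v = qform M (v *m S ^t*).
Proof. by rewrite /qform !adjmxE !mulmxA. Qed.

Lemma qform_gram n k (G : 'M[C]_(n, k)) v :
  qform (G *m G ^t*) v = \sum_i `|(v *m G) 0 i| ^+ 2.
Proof.
rewrite /qform mulmxA -mulmxA -adjmxM mxE; apply: eq_bigr => i _.
by rewrite !mxE normCK.
Qed.

Lemma qform1 n (v : 'rV[C]_n) : qform 1%:M v = \sum_i `|v 0 i| ^+ 2.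
Proof.
have := qform_gram 1%:M v; rewrite adjmx1 mulmx1 => ->.
by rewrite mulmx1.
Qed.

Lemma sumsq_eq0 n (v : 'rV[C]_n) : (\sum_i `|v 0 i| ^+ 2 == 0) = (v == 0).
Proof.
rewrite psumr_eq0 => [|i _]; last by rewrite exprn_ge0.
apply/allP/eqP => [h|-> i _]; last by rewrite mxE normr0 expr0n eqxx.
apply/rowP => i; have := h i (mem_index_enum _).
by rewrite implyTb mxE sqrf_eq0 normr_eq0 => /eqP.
Qed.

Lemma qform1_gt0 n (v : 'rV[C]_n) : v != 0 -> 0 < qform 1%:M v.
Proof.
move=> v0; rewrite qform1 lt_def sumsq_eq0 v0 sumr_ge0 // => i _.
by rewrite exprn_ge0.
Qed.

Lemma psd_gram n k (G : 'M[C]_(n, k)) : psd (G *m G ^t*).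
Proof. by move=> v; rewrite qform_gram sumr_ge0 // => i _; rewrite exprn_ge0. Qed.

Lemma qform_gram_eq0 n k (G : 'M[C]_(n, k)) v :
  qform (G *m G ^t*) v = 0 -> v *m G = 0.
Proof. by rewrite qform_gram => /eqP; rewrite sumsq_eq0 => /eqP. Qed.

Lemma hermsymmxP n (X : 'M[C]_n) : reflect (X ^t* = X) (X \is hermsymmx).
Proof.
apply: (iffP (@is_hermitianmxP C n false Num.conj X)); rewrite expr0 scale1r => h.
  by rewrite -h.
by rewrite h.
Qed.

Lemma hermitian_spectral n (X : 'M[C]_n) : X ^t* = X ->
  exists P (d : 'rV[C]_n), [/\ P \is unitarymx, d \is a mxOver Num.real &
    X = P ^t* *m diag_mx d *m P].
Proof.
move=> /hermsymmxP hX; exists (spectralmx X), (spectral_diag X).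
split; first exact: spectral_unitarymx.
  exact: hermitian_spectral_diag_real.
have /hermitian_normalmx/orthomx_spectralP {1}-> := hX.
by rewrite invmx_unitary // spectral_unitarymx.
Qed.

Lemma qform_spectral_row n (P : 'M[C]_n) (d : 'rV[C]_n) i : P \is unitarymx ->
  qform (P ^t* *m diag_mx d *m P) (row i P) = d 0 i.
Proof.
move=> /unitarymxP PP; rewrite qform_congr -row_mul PP qform_diag.
rewrite (bigD1 i) //= big1 ?addr0 => [|j /negPf ji].
  by rewrite !mxE eqxx normr1 expr1n mulr1.
by rewrite !mxE eq_sym ji normr0 expr0n mulr0.
Qed.

Lemma unitary_row_neq0 n (P : 'M[C]_n) i : P \is unitarymx -> row i P != 0.
Proof.
move=> /unitarymx_unit Pu; apply/eqP => h.
have := row_mul i P (invmx P); rewrite mulmxV // h mul0mx => /rowP/(_ i).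
by rewrite !mxE eqxx => /eqP; rewrite oner_eq0.
Qed.

(** With [X = P^* d P], take [S = d^(1/2) P]; the entries of [d] are values of the form of [X] at
    the rows of [P], hence positive. *)
Lemma posdef_factor n (X : 'M[C]_n) : posdef X ->
  exists2 S : 'M[C]_n, S \in unitmx & X = S ^t* *m S.
Proof.
move=> [hX pX]; have [P [d [Pu dr XE]]] := hermitian_spectral hX.
have dp i : 0 < d 0 i.
  by rewrite -(qform_spectral_row d i Pu) -XE pX // unitary_row_neq0.
pose s := map_mx sqrtC d.
have sr : s \is a mxOver Num.real.
  by apply/mxOverP => i j; rewrite mxE ger0_real // sqrtC_ge0 ord1 ltW.
exists (diag_mx s *m P).
  rewrite unitmx_mul (unitarymx_unit Pu) andbT unitmxE det_diag unitfE.
  by apply/prodf_neq0 => i _; rewrite mxE sqrtC_eq0 gt_eqF.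
rewrite adjmxM adjmx_diag_real // -mulmxA [diag_mx s *m _]mulmxA mulmx_diag XE -mulmxA.
congr (_ *m (diag_mx _ *m _)); apply/rowP => i.
by rewrite !mxE -expr2 sqrtCK.
Qed.

Lemma simultaneous_diag n (X D : 'M[C]_n) : posdef X -> D ^t* = D ->
  exists T (d : 'rV[C]_n), [/\ T \in unitmx, d \is a mxOver Num.real,
    X = T ^t* *m T & D = T ^t* *m diag_mx d *m T].
Proof.
move=> pX hD; have [S Su XE] := posdef_factor pX.
have Su' : S ^t* \in unitmx by rewrite map_unitmx unitmx_tr.
pose G := invmx (S ^t*) *m D *m invmx S.
have hG : G ^t* = G.
  by rewrite !adjmxM hD adjmx_inv -[invmx (S ^t*)]adjmx_inv trmxCK mulmxA adjmx_inv.
have [V [d [Vu dr GE]]] := hermitian_spectral hG.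
exists (V *m S), d; split => //.
- by rewrite unitmx_mul Su unitarymx_unit.
- rewrite adjmxM -mulmxA [V ^t* *m _]mulmxA.
  by move: (Vu) => /unitarymxP/mulmx1C ->; rewrite mul1mx.
rewrite adjmxM -!mulmxA [V ^t* *m _]mulmxA [_ *m diag_mx d *m _]mulmxA -GE.
by rewrite /G -!mulmxA mulVmx // mulmx1 mulKVmx.
Qed.

(** A common congruence turns [X] into [1] and [D] into a real diagonal [d]. If some [d_i] is
    negative, [t = -1 / d_i] makes the corresponding entry of [1 + t d] vanish. *)
Lemma psd_or_singular n (X D : 'M[C]_n) : posdef X -> D ^t* = D ->
  psd D \/ exists (t : C) (v : 'rV_n), [/\ 0 < t, v != 0 & v *m (X + t *: D) = 0].
Proof.
move=> pX hD; have [T [d [Tu dr XE DE]]] := simultaneous_diag pX hD.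
case: (pickP (fun i => ~~ (0 <= d 0 i))) => [i|dp]; last first.
  left => v; rewrite DE qform_congr qform_diag sumr_ge0 // => i _.
  by rewrite mulr_ge0 ?exprn_ge0 //; apply/negbFE/dp.
rewrite -real_ltNge ?real0 ?(mxOverP dr) //.
move=> di; right.
have Tu' : T ^t* \in unitmx by rewrite map_unitmx unitmx_tr.
exists (- (d 0 i)^-1), (row i (invmx (T ^t*))); split.
- by rewrite oppr_gt0 invr_lt0.
- apply/eqP => h; have := row_mul i (invmx (T ^t*)) (T ^t*).
  rewrite mulVmx // h mul0mx => /rowP/(_ i).
  by rewrite !mxE eqxx => /eqP; rewrite oner_eq0.
have -> : X + - (d 0 i)^-1 *: D = T ^t* *m ((1%:M - (d 0 i)^-1 *: diag_mx d) *m T).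
  by rewrite XE DE; mxring.
rewrite -row_mul mulKmx // row_mul (_ : row i _ = 0) ?mul0mx //.
apply/rowP => j; rewrite !mxE; case: eqP => _.
  by rewrite !mulr1n mulVf ?subrr // lt_eqF.
by rewrite !mulr0n mulr0 subr0.
Qed.

Lemma entry_form n (Z : 'M[C]_n) i j :
  delta_mx (0 : 'I_1) i *m Z *m (delta_mx (0 : 'I_1) j) ^t* = (Z i j)%:M.
Proof.
rewrite trmx_delta map_delta_mx -rowE -colE; apply/matrixP => k l.
by rewrite !ord1 !mxE mulr1n.
Qed.

Lemma qform_delta n (Z : 'M[C]_n) i : qform Z (delta_mx 0 i) = Z i i.
Proof. by rewrite /qform entry_form mxE. Qed.

(** Test the form on [e_i + u e_j], where the unimodular [u] turns both cross terms into [-|Z_ij|]: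
    this gives [2 |Z_ij| <= Z_ii + Z_jj]. *)
Lemma psd_entry_le n (Z : 'M[C]_n) a i j : Z ^t* = Z -> psd Z ->
  (forall k, Z k k <= a) -> `|Z i j| <= a.
Proof.
move=> hZ pZ Za.
have Zji : Z j i = (Z i j)^* by rewrite -{1}hZ !mxE.
have [u uu ZE] : exists2 u : C, `|u| = 1 & Z i j * u^* = - `|Z i j|.
  have [z0|z0] := eqVneq (Z i j) 0.
    by exists 1; rewrite ?normr1 // z0 normr0 mul0r oppr0.
  exists (- (Z i j / `|Z i j|)).
    by rewrite normrN normf_div normr_id divff // normr_eq0.
  rewrite rmorphN rmorphM fmorphV /= (CrealP (normr_real _)) mulrN mulrA -normCK.
  by rewrite expr2 mulfK // normr_eq0.
have := pZ (delta_mx 0 i + u *: delta_mx 0 j).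
rewrite /qform adjmxD adjmxZ; mxexpand.
rewrite !entry_form !mx_entryE !mxE !mulr1n Zji.
have e1 : u * (Z i j)^* = - `|Z i j|.
  by rewrite -[u]conjCK -rmorphM mulrC /= ZE rmorphN /= (CrealP (normr_real _)).
have e2 : u * u^* = 1 by rewrite -normCK uu expr1n.
have -> : Z i i + u^* * Z i j + u * ((Z i j)^* + u^* * Z j j) =
    Z i i + Z j j - `|Z i j| *+ 2.
  rewrite mulrDr e1 mulrA e2 mulrC ZE; ring.
rewrite subr_ge0 => h.
have : `|Z i j| *+ 2 <= a *+ 2 by rewrite (le_trans h) // mulr2n lerD.
by rewrite lerMn2r.
Qed.

(** The diagonal of [D + a] is at most [2 a], hence so are the moduli of all its entries;
    subtracting the scalar matrix costs one more [a]. *)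
Lemma entry_bound_of_psd n (D : 'M[C]_n) a i j : D ^t* = D -> 0 <= a ->
  psd (D + a%:M) -> psd (a%:M - D) -> `|D i j| <= a *+ 3.
Proof.
move=> hD a0 p1 p2.
have ha : (a%:M : 'M[C]_n) ^t* = a%:M.
  by rewrite -scalemx1 adjmxZ adjmx1 (CrealP (ger0_real a0)).
have h : `|(D + a%:M) i j| <= a *+ 2.
  apply: psd_entry_le; rewrite ?adjmxD ?hD ?ha // => k.
  have := p2 (delta_mx 0 k); rewrite qform_delta !mxE eqxx mulr1n subr_ge0 => h.
  by rewrite mulr2n lerD2r.
have -> : D i j = (D + a%:M) i j - (a%:M : 'M_n) i j by rewrite mxE addrK.
rewrite (le_trans (ler_normB _ _)) // (mulrSr _ 2) lerD //.
by rewrite !mxE; case: eqP; rewrite ?mulr1n ?mulr0n ?normr0 // ger0_norm.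
Qed.
End HermitianForms.

(** * The entrywise norm *)

Section EntrywiseNorm.
Variable C : numClosedFieldType.

(** This norm takes values in [C] and needs no supremum, so the estimates make sense over any
    [numClosedFieldType]; the comparison with [opnorm] comes at the end. *)
Definition mxnorm1 m n (M : 'M[C]_(m, n)) : C := \sum_i \sum_j `|M i j|.

Lemma mxnorm1_ge0 m n (M : 'M[C]_(m, n)) : 0 <= mxnorm1 M.
Proof. by do 2!apply: sumr_ge0 => ? _. Qed.

Lemma mxnorm1D m n (M P : 'M[C]_(m, n)) :
  mxnorm1 (M + P) <= mxnorm1 M + mxnorm1 P.
Proof.
rewrite -big_split ler_sum //= => i _; rewrite -big_split ler_sum //= => j _.
by rewrite mxE ler_normD.
Qed.

Lemma mxnorm1N m n (M : 'M[C]_(m, n)) : mxnorm1 (- M) = mxnorm1 M.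
Proof. by do 2!apply: eq_bigr => ? _; rewrite mxE normrN. Qed.

Lemma mxnorm1Z m n a (M : 'M[C]_(m, n)) : mxnorm1 (a *: M) = `|a| * mxnorm1 M.
Proof. by do 2!(rewrite mulr_sumr; apply: eq_bigr => ? _); rewrite mxE normrM. Qed.

Lemma mxnorm1_adj m n (M : 'M[C]_(m, n)) : mxnorm1 (M ^t*) = mxnorm1 M.
Proof.
rewrite [LHS]exchange_big; do 2!apply: eq_bigr => ? _.
by rewrite !mxE norm_conjC.
Qed.

Lemma mxnorm1M m n p (M : 'M[C]_(m, n)) (P : 'M_(n, p)) :
  mxnorm1 (M *m P) <= mxnorm1 M * mxnorm1 P.
Proof.
rewrite mulr_suml ler_sum // => i _; rewrite mulr_suml.
apply: le_trans (_ : \sum_k \sum_j `|M i j| * `|P j k| <= _).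
  rewrite ler_sum // => k _; rewrite mxE (le_trans (ler_norm_sum _ _ _)) //.
  by rewrite ler_sum // => j _; rewrite normrM.
rewrite exchange_big ler_sum //= => j _; rewrite -mulr_sumr ler_wpM2l //.
by rewrite /mxnorm1 (bigD1 j) //= lerDl; do 2!apply: sumr_ge0 => ? _.
Qed.

Lemma mxnorm1_le m n (M : 'M[C]_(m, n)) a :
  (forall i j, `|M i j| <= a) -> mxnorm1 M <= a *+ (m * n).
Proof.
move=> h; apply: le_trans (_ : \sum_(i < m) \sum_(j < n) a <= _).
  by do 2!(rewrite ler_sum // => ? _).
by rewrite !sumr_const !card_ord -mulrnA mulnC.
Qed.

Lemma mxnorm1_leD m n (M P : 'M[C]_(m, n)) a b :
  mxnorm1 M <= a -> mxnorm1 P <= b -> mxnorm1 (M + P) <= a + b.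
Proof. by move=> h1 h2; rewrite (le_trans (mxnorm1D _ _)) // lerD. Qed.

Lemma mxnorm1_leM m n p (M : 'M[C]_(m, n)) (P : 'M_(n, p)) a b :
  mxnorm1 M <= a -> mxnorm1 P <= b -> mxnorm1 (M *m P) <= a * b.
Proof.
by move=> h1 h2; rewrite (le_trans (mxnorm1M _ _)) // ler_pM // mxnorm1_ge0.
Qed.

(** Each product [|v_i| |v_j|] is at most the larger of the two squares, hence at most the squared
    length of [v]. *)
Lemma norm_qform_le n (Z : 'M[C]_n) v :
  `|qform Z v| <= mxnorm1 Z * qform 1%:M v.
Proof.
have sq i : `|v 0 i| ^+ 2 <= qform 1%:M v.
  rewrite qform1 (bigD1 i) //= lerDl sumr_ge0 // => j _.
  by rewrite exprn_ge0.
have vij i j : `|v 0 i| * `|v 0 j| <= qform 1%:M v.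
  case: (real_leP (normr_real (v 0 i)) (normr_real (v 0 j))) => [h|/ltW h].
    by rewrite (le_trans _ (sq j)) // expr2 ler_wpM2r.
  by rewrite (le_trans _ (sq i)) // expr2 ler_wpM2l.
rewrite {1}/qform mxE (le_trans (ler_norm_sum _ _ _)) // [mxnorm1 Z]exchange_big.
rewrite mulr_suml ler_sum //= => j _.
rewrite mxE mulr_suml (le_trans (ler_norm_sum _ _ _)) // mulr_suml ler_sum //= => i _.
rewrite !normrM !mxE norm_conjC -mulrA mulrCA.
by apply: ler_wpM2l.
Qed.

Lemma qform_scalar n a (v : 'rV[C]_n) : qform a%:M v = a * qform 1%:M v.
Proof. by rewrite -(scalemx1 _ a) qformZ. Qed.

Lemma qform_real n (Z : 'M[C]_n) v : Z ^t* = Z -> qform Z v \is Num.real.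
Proof.
move=> hZ; apply/CrealP; rewrite /qform.
transitivity (((v *m Z *m v ^t*) ^t*) 0 0); first by rewrite !mxE.
by rewrite !adjmxE hZ mulmxA.
Qed.

Lemma qform_le_norm n (Z : 'M[C]_n) v : Z ^t* = Z ->
  qform Z v <= mxnorm1 Z * qform 1%:M v.
Proof.
by move=> hZ; rewrite (le_trans _ (norm_qform_le _ _)) // real_ler_norm // qform_real.
Qed.

Lemma qform1_ge0 n (v : 'rV[C]_n) : 0 <= qform 1%:M v.
Proof. by rewrite qform1 sumr_ge0 // => i _; rewrite exprn_ge0. Qed.

Lemma mxnorm1_le_psd n (D : 'M[C]_n) a : D ^t* = D -> 0 <= a ->
  psd (D + a%:M) -> psd (a%:M - D) -> mxnorm1 D <= a *+ (3 * (n * n)).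
Proof.
by move=> hD a0 p1 p2; rewrite mulrnA mxnorm1_le // => i j; apply: entry_bound_of_psd.
Qed.
End EntrywiseNorm.

(* The Popov-Belevitch-Hautus form of controllability. *)
Definition controllable (C : numClosedFieldType) n m (A : 'M[C]_n)
    (B : 'M[C]_(n, m)) :=
  forall l (v : 'rV_n), v != 0 -> v *m A = l *: v -> v *m B = 0 -> False.

(** * The Lyapunov equation *)

Section Lyapunov.
Variables (C : numClosedFieldType) (n : nat).
Implicit Types (K X Q Z D : 'M[C]_n).

Definition lyap K Z := K *m Z + Z *m K ^t*.

Lemma qform_lyap_ker K Z v : Z ^t* = Z -> v *m Z = 0 -> qform (lyap K Z) v = 0.
Proof.
move=> hZ vZ; rewrite /qform /lyap; mxexpand; rewrite vZ !mul0mx addr0.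
by rewrite -mulmxA -{1}hZ -adjmxM vZ trmx0 map_mx0 mulmx0 mxE.
Qed.

Lemma lyapD K Z D : lyap K (Z + D) = lyap K Z + lyap K D.
Proof. by rewrite /lyap; mxring. Qed.

Lemma lyapZ K a Z : lyap K (a *: Z) = a *: lyap K Z.
Proof. by rewrite /lyap; mxring. Qed.

Lemma adjmx_real_comb X D t : 0 <= t -> X ^t* = X -> D ^t* = D ->
  (X + t *: D) ^t* = X + t *: D.
Proof. by move=> t0 hX hD; rewrite !adjmxE hX hD (CrealP (ger0_real t0)). Qed.

(** Otherwise [Q + t Z] has a kernel vector for some [t > 0]; the form of [lyap K (Q + t Z)]
    vanishes there, although it is a negative term plus a nonpositive one. *)
Lemma lyap_comparison K Q Z : posdef Q ->
  (forall v, v != 0 -> qform (lyap K Q) v < 0) ->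
  Z ^t* = Z -> psd (- lyap K Z) -> psd Z.
Proof.
move=> pQ nQ hZ pZ; case: (psd_or_singular pQ hZ) => // -[t [v [t0 v0 vQZ]]].
have hQZ := adjmx_real_comb (ltW t0) pQ.1 hZ.
have := qform_lyap_ker K hQZ vQZ; rewrite lyapD lyapZ qformD qformZ => e.
have := nQ v v0; rewrite -oppr_gt0 (addr0_eq e) => h.
have := pZ v; rewrite qformN oppr_ge0 => h'.
by have := lt_le_trans h (mulr_ge0_le0 (ltW t0) h'); rewrite ltxx.
Qed.

(** On a basis of the invariant row space [K] acts as a square matrix [M], which has an eigenvalue
    since [C] is algebraically closed. *)
Lemma stable_eigenvector m K (V : 'M[C]_(m, n)) : V != 0 -> (V *m K <= V)%MS ->
  exists l (v : 'rV_n), [/\ v != 0, (v <= V)%MS & v *m K = l *: v].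
Proof.
move=> V0 VK; set b := row_base V.
have bK : (b *m K <= b)%MS.
  by rewrite (eqmxMr K (eq_row_base V)) (submx_trans VK) // eq_row_base.
have [M ME] := submxP bK.
have r0 : (0 < \rank V)%N by rewrite lt0n mxrank_eq0.
have [l /eigenvalueP [u uM u0]] := eigenvalue_closed M r0.
exists l, (u *m b); split.
- apply: contra u0 => /eqP ub0; apply/eqP.
  by apply: (row_free_inj (row_base_free V)); rewrite mul0mx.
- by rewrite (submx_trans (submxMl _ _)) // eq_row_base.
by rewrite -mulmxA ME mulmxA uM scalemxAl.
Qed.

Variables (p : nat) (G : 'M[C]_(n, p)) (K X : 'M[C]_n).
Hypothesis pX : posdef X.
Hypothesis KX : lyap K X = - (G *m G ^t*).
Hypothesis KG : controllable K G.

(** The form of [G G^*] vanishes on the kernel of [Z], so this kernel annihilates [G]; multiplying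
    the equation by a kernel vector then shows that the kernel is [K]-invariant. If nonzero, it
    would contain an eigenvector of [K] annihilating [G], against controllability. *)
Lemma lyap_ker_trivial Z (v : 'rV_n) : Z ^t* = Z -> lyap K Z = - (G *m G ^t*) ->
  v *m Z = 0 -> v = 0.
Proof.
move=> hZ KZ vZ; apply/eqP; apply/negPn/negP => v0.
have key (u : 'rV_n) : u *m Z = 0 -> u *m G = 0.
  move=> uZ; apply: qform_gram_eq0; apply/eqP; rewrite -oppr_eq0 -qformN -KZ.
  by rewrite qform_lyap_ker.
have ker0 : kermx Z != 0.
  apply: contra v0 => /eqP k0; have : (v <= kermx Z)%MS by apply/sub_kermxP.
  by rewrite k0 submx0.
have [|l [u [u0 uZ uK]]] := @stable_eigenvector _ K _ ker0.
  apply/sub_kermxP/row_matrixP => i; rewrite row0 -mulmxA row_mul.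
  set u := row i _.
  have uZ : u *m Z = 0 by apply/sub_kermxP; exact: row_sub.
  have := congr1 (mulmx u) KZ; rewrite /lyap mulmxN mulmxDr !mulmxA uZ.
  by rewrite (key u uZ) !mul0mx addr0 oppr0.
by apply: (KG u0 uK); apply: key; apply/sub_kermxP.
Qed.

(** Adding [t D] to [X] leaves the Lyapunov equation unchanged, so [X + t D] is never singular for
    [t > 0]. Hence [D] is positive semidefinite, and so is [- D]. *)
Lemma lyap_inj_herm D : D ^t* = D -> lyap K D = 0 -> D = 0.
Proof.
have ppsd Z : Z ^t* = Z -> lyap K Z = 0 -> psd Z.
  move=> hZ KZ; case: (psd_or_singular pX hZ) => // -[t [v [t0 v0 vZ]]].
  case/eqP: v0; apply: lyap_ker_trivial vZ; last by rewrite lyapD lyapZ KZ scaler0 addr0.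
  exact: adjmx_real_comb (ltW t0) pX.1 hZ.
move=> hD KD.
have hD' : (- D) ^t* = - D by rewrite adjmxN hD.
have KD' : lyap K (- D) = 0 by rewrite -scaleN1r lyapZ KD scaler0.
apply/matrixP => i j; rewrite mxE; apply/eqP; rewrite -normr_le0.
rewrite -[0](mul0rn _ 3); apply: entry_bound_of_psd; rewrite // ?scalemx0 raddf0.
  by rewrite addr0; apply: ppsd.
by rewrite sub0r; apply: ppsd.
Qed.

Lemma lyap_inj D : lyap K D = 0 -> D = 0.
Proof.
move=> KD.
have KD' : lyap K (D ^t*) = 0.
  rewrite -[RHS](map_mx0 Num.conj) -trmx0 -KD /lyap adjmxD !adjmxM trmxCK.
  by rewrite addrC.
have h1 : D + D ^t* = 0.
  by apply: lyap_inj_herm; rewrite ?lyapD ?KD ?KD' ?addr0 // adjmxD trmxCK addrC.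
have h2 : 'i *: (D - D ^t*) = 0.
  apply: lyap_inj_herm; last first.
    by rewrite lyapZ lyapD -scaleN1r lyapZ KD KD' !scaler0 addr0 scaler0.
  by rewrite !adjmxE; apply/matrixP => i j; rewrite !mx_entryE; ring.
have {}h2 : D = D ^t*.
  by apply/eqP; rewrite -subr_eq0; move/eqP: h2; rewrite scaler_eq0 (negPf (neq0Ci _)).
move: h1; rewrite -h2 -mulr2n -scaler_nat => /eqP.
by rewrite scaler_eq0 pnatr_eq0 => /eqP.
Qed.

(** An injective endomorphism of the space of matrices, of dimension [n * n], is onto. *)
Lemma lyap_surj Y : exists D, lyap K D = Y.
Proof.
pose M := lin_mulmx K + lin_mulmxr (K ^t*) : 'M[C]_(n * n).
have ME D : mxvec D *m M = mxvec (lyap K D).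
  by rewrite /M mulmxDr !mul_rV_lin /= !mxvecK -linearD.
have Mu : M \in unitmx.
  rewrite -row_free_unit; apply: inj_row_free => v.
  rewrite -[v]vec_mxK ME => /(congr1 vec_mx); rewrite mxvecK linear0.
  by move=> /lyap_inj ->; rewrite linear0.
exists (vec_mx (mxvec Y *m invmx M)); apply: (can_inj mxvecK).
by rewrite -ME vec_mxK mulmxKV.
Qed.

Lemma lyap_strict : exists2 Q, posdef Q & lyap K Q = - 1%:M.
Proof.
have [Q KQ] := lyap_surj (- 1%:M); exists Q => //.
have hQ : Q ^t* = Q.
  apply/eqP; rewrite -subr_eq0; apply/eqP; apply: lyap_inj.
  rewrite lyapD -scaleN1r lyapZ KQ.
  have -> : lyap K (Q ^t*) = (lyap K Q) ^t* by rewrite /lyap !adjmxE addrC.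
  by rewrite KQ adjmxN adjmx1 scaleN1r addrN.
(* Positivity of [Q] follows from [Q >= s X]. The choice of [s] gives [s g < 1], so [- 1 + s G G^*]
   has a negative form, which excludes a kernel vector of [X + t (Q - s X)]. *)
pose g := mxnorm1 (G *m G ^t*); pose s := (1 + g)^-1.
have g0 : 0 <= g by exact: mxnorm1_ge0.
have s0 : 0 < s by rewrite invr_gt0 ltr_wpDr.
have hQX : (Q - s *: X) ^t* = Q - s *: X.
  by rewrite !adjmxE hQ pX.1 (CrealP (ger0_real (ltW s0))).
suff pQX : psd (Q - s *: X).
  split=> // v v0; rewrite -[Q](subrK (s *: X)) qformD qformZ.
  by rewrite ltr_wpDl ?mulr_gt0 ?pX.2.
case: (psd_or_singular pX hQX) => // -[t [v [t0 v0 vZ]]].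
have := qform_lyap_ker K (adjmx_real_comb (ltW t0) pX.1 hQX) vZ.
rewrite !lyapD lyapZ lyapD -scaleNr lyapZ KQ KX scaleNr.
rewrite !(qformD, qformN, qformZ) => /eqP; rewrite lt_eqF //.
rewrite ltr_wnDl //; first by rewrite oppr_le0 psd_gram.
rewrite pmulr_rlt0 // mulNr mulrN opprK addrC subr_lt0.
apply: (@le_lt_trans _ _ (s * (g * qform 1%:M v))).
  rewrite ler_wpM2l ?(ltW s0) //; apply: qform_le_norm; by rewrite adjmxM trmxCK.
rewrite mulrA gtr_pMl ?qform1_gt0 // /s mulrC ltr_pdivrMr ?ltr_wpDr // mul1r.
by rewrite ltrDr.
Qed.
End Lyapunov.

(** * Inverses of positive definite matrices and scalar bounds *)

Section PosdefInverse.
Variables (C : numClosedFieldType) (n : nat).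
Implicit Types (X Z : 'M[C]_n).

Lemma posdef_unit X : posdef X -> X \in unitmx.
Proof.
move=> /posdef_factor [S Su ->].
by rewrite unitmx_mul map_unitmx unitmx_tr Su.
Qed.

Lemma posdef_inv X : posdef X -> posdef (invmx X).
Proof.
move=> pX; have Xu := posdef_unit pX; have [hX X0] := pX.
have hY : (invmx X) ^t* = invmx X by rewrite adjmx_inv hX.
split=> // v v0.
have -> : invmx X = (invmx X) ^t* *m X *m invmx X by rewrite hY mulVmx // mul1mx.
rewrite qform_congr X0 // hY; apply: contra v0 => /eqP h.
by rewrite -[v](mulmxKV Xu) h mul0mx.
Qed.

Lemma posdef_psd X : posdef X -> psd X.
Proof.
move=> [_ pX] v; have [->|v0] := eqVneq v 0; last exact/ltW/pX.
by rewrite /qform !mul0mx mxE.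
Qed.

Lemma psd_le_scalar X Z a b : Z ^t* = Z -> 0 <= a -> a * mxnorm1 Z <= b ->
  psd (X + a *: Z) -> psd (X + b%:M).
Proof.
move=> hZ a0 ab p v; rewrite (le_trans (p v)) // !qformD lerD2l qformZ.
rewrite qform_scalar (le_trans (ler_wpM2l a0 (qform_le_norm v hZ))) //.
by rewrite mulrA ler_wpM2r // qform1_ge0.
Qed.

Lemma psd_mono_scalar X a b : a <= b -> psd (X + a%:M) -> psd (X + b%:M).
Proof.
move=> ab p v; rewrite (le_trans (p v)) // !qformD lerD2l (qform_scalar a) (qform_scalar b).
by rewrite ler_wpM2r // qform1_ge0.
Qed.

(* [X' - X - X (X^-1 - X'^-1) X = (X' - X) X'^-1 (X' - X)] is positive
   semidefinite, so an upper bound on the inverse of [X'] is a lower bound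
   on [X']. *)
Lemma psd_inv_lower X X' e : posdef X -> posdef X' -> 0 <= e ->
  psd (invmx X - invmx X' + e%:M) ->
  psd (X' - X + (e * (mxnorm1 X * mxnorm1 X))%:M).
Proof.
move=> pX pX' e0 pe; have [hX _] := pX; have [hX' _] := pX'.
have Xu := posdef_unit pX; have Xu' := posdef_unit pX'.
have hD : (X' - X) ^t* = X' - X by rewrite adjmxD adjmxN hX hX'.
apply: (@psd_le_scalar _ (X *m X) e); rewrite ?adjmxM ?hX ?ler_wpM2l ?mxnorm1M //.
have -> : X' - X + e *: (X *m X) = X ^t* *m (invmx X - invmx X' + e%:M) *m X +
    (X' - X) ^t* *m invmx X' *m (X' - X).
  rewrite hD hX -scalemx1; mxexpand; rewrite mulmxV // mulmxV // !mul1mx.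
  rewrite -[X *m invmx X' *m X']mulmxA mulVmx // mulmx1.
  by apply/matrixP => i j; rewrite !mx_entryE; ring.
move=> v; rewrite qformD !qform_congr addr_ge0 //.
exact: posdef_psd (posdef_inv pX') _.
Qed.
End PosdefInverse.

(** * Upper bound for solutions of a perturbed Riccati equation *)

Section GramNorm.
Variable C : numClosedFieldType.

Lemma mxnorm1_gram_le n p (B B' : 'M[C]_(n, p)) d : d <= 1 ->
  mxnorm1 (B' - B) <= d ->
  mxnorm1 (B' *m B' ^t* - B *m B ^t*) <= (1 + mxnorm1 B *+ 2) * d.
Proof.
move=> d1 dB.
have -> : B' *m B' ^t* - B *m B ^t* =
    (B' - B) *m B' ^t* + B *m (B' - B) ^t* by rewrite !adjmxE; mxring.
have -> : (1 + mxnorm1 B *+ 2) * d = d * (1 + mxnorm1 B) + mxnorm1 B * d by ring.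
apply: mxnorm1_leD; apply: mxnorm1_leM; rewrite ?mxnorm1_adj //.
by rewrite -[B'](subrK B) mxnorm1_leD // (le_trans dB).
Qed.
End GramNorm.

Section CareUpperBound.
Variables (C : numClosedFieldType) (n m1 m2 : nat).

(** The acronym stands for continuous-time algebraic Riccati equation. *)
Definition care (N : 'M[C]_n) (B : 'M[C]_(n, m1)) (H : 'M[C]_(m2, n)) X :=
  N *m X + X *m N ^t* - X *m H ^t* *m H *m X + B *m B ^t*.

(** Completion of the square in the gain [L]: the first square vanishes at the optimal gain [X H^*]
    and is nonnegative at any other. *)
Lemma lyap_gain (N : 'M[C]_n) B (H : 'M[C]_(m2, n)) X L : X ^t* = X ->
  care N B H X = 0 ->
  lyap (N - L *m H) X =
    (X *m H ^t* - L) *m (X *m H ^t* - L) ^t* - L *m L ^t* - B *m B ^t*.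
Proof.
move=> hX cX; rewrite -[LHS]subr0 -cX /care /lyap !adjmxE hX; mxring.
Qed.

Lemma mxnorm1_lyap (K Z : 'M[C]_n) k : mxnorm1 K <= k ->
  mxnorm1 (lyap K Z) <= (k * mxnorm1 Z) *+ 2.
Proof.
move=> hk; rewrite mulr2n mxnorm1_leD //; first by rewrite mxnorm1_leM.
by rewrite mulrC mxnorm1_leM ?mxnorm1_adj.
Qed.

Variables (N : 'M[C]_n) (B : 'M[C]_(n, m1)) (H : 'M[C]_(m2, n)) (X : 'M[C]_n).
Hypothesis pX : posdef X.
Hypothesis cX : care N B H X = 0.
Hypothesis NB : controllable N B.

(* [Q] certifies the stability of the optimal filter [N - X H^* H], hence of
   [N' - X H^* H'] for nearby data; the latter filter is suboptimal for the
   perturbed equation, which bounds its solution from above. *)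
Lemma care_upper_bound : exists c d0 : C, [/\ 0 <= c, 0 < d0 &
  forall d (N' : 'M_n) (B' : 'M_(n, m1)) (H' : 'M_(m2, n)) (X' : 'M_n),
    0 <= d -> d <= d0 ->
    mxnorm1 (N' - N) <= d -> mxnorm1 (B' - B) <= d -> mxnorm1 (H' - H) <= d ->
    X' ^t* = X' -> care N' B' H' X' = 0 -> psd (X - X' + (c * d)%:M)].
Proof.
have [hX _] := pX.
(* [L] is the optimal gain of the unperturbed data and [K] its closed loop; [G] joins [L] and [B] so
   that the right-hand side is a single Gram matrix. *)
pose L := X *m H ^t*; pose K := N - L *m H; pose G := row_mx L B.
have LE : X *m H ^t* - L = 0 by rewrite subrr.
have GG : G *m G ^t* = L *m L ^t* + B *m B ^t*.
  by rewrite tr_row_mx map_col_mx mul_row_col.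
have KX : lyap K X = - (G *m G ^t*).
  by rewrite /K (lyap_gain L hX cX) LE GG mul0mx sub0r opprD.
have KG : controllable K G.
  move=> l v v0; rewrite mul_mx_row -row_mx0 => vK /eq_row_mx [vL vB].
  by apply: (@NB l v v0 _ vB); rewrite -vK /K mulmxBr mulmxA vL mul0mx subr0.
have [Q pQ KQ] := lyap_strict pX KX KG.
pose k := 1 + mxnorm1 L; pose q := mxnorm1 Q; pose x := mxnorm1 X.
pose b := mxnorm1 B; pose c0 := (1 + b *+ 2) + (k * x) *+ 2.
have k0 : 0 <= k by rewrite addr_ge0 ?mxnorm1_ge0.
have q0 : 0 <= q by exact: mxnorm1_ge0.
have x0 : 0 <= x by exact: mxnorm1_ge0.
have b0 : 0 <= b by exact: mxnorm1_ge0.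
have c00 : 0 <= c0 by rewrite !addr_ge0 ?mulrn_wge0 ?mulr_ge0.
have kq0 : 0 <= (k * q) *+ 4 by rewrite mulrn_wge0 // mulr_ge0.
(* The threshold forces [4 k q d < 1], so replacing [K] by [K'] changes [lyap K Q] by less than
   [1/2]. With [s = 2 c0 d], half of [s] absorbs this change; the other half, [c0 d], absorbs the
   changes in [B B^*] and [lyap K X]. The factor [q] bounds [Q] by a scalar. *)
exists ((c0 *+ 2) * q), (1 + (k * q) *+ 4)^-1; split.
- by rewrite mulr_ge0 // mulrn_wge0.
- by rewrite invr_gt0 ltr_wpDr.
move=> d N' B' H' X' d_ge0 dd0 dN dB dH hX' cX'.
have kqd : ((k * d * q) *+ 2) *+ 2 < 1.
  apply: le_lt_trans (_ : (k * q) *+ 4 * (1 + (k * q) *+ 4)^-1 < 1).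
    have -> : ((k * d * q) *+ 2) *+ 2 = ((k * q) *+ 4) * d by ring.
    by rewrite ler_wpM2l.
  by rewrite ltr_pdivrMr ?ltr_wpDr // mul1r ltrDr.
have d1 : d <= 1.
  by rewrite (le_trans dd0) // invf_le1 ?ltr_wpDr // lerDl.
pose K' := N' - L *m H'; pose s := (c0 *+ 2) * d.
have s0 : 0 <= s by rewrite mulr_ge0 // mulrn_wge0.
pose dK := K' - K.
have dKk : mxnorm1 dK <= k * d.
  have -> : dK = N' - N + - (L *m (H' - H)) by rewrite /dK /K' /K; mxring.
  rewrite mulrDl mul1r mxnorm1_leD ?mxnorm1N //.
  by rewrite mxnorm1_leM.
have lyapE Z : lyap K' Z = lyap K Z + lyap dK Z.
  by rewrite /dK /lyap !adjmxE; mxring.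
have dKQ := mxnorm1_lyap Q dKk; have dKX := mxnorm1_lyap X dKk.
have hl Z : Z ^t* = Z -> (lyap dK Z) ^t* = lyap dK Z.
  by move=> hZ; rewrite /lyap !adjmxE hZ addrC.
pose Z := X + s *: Q - X'.
have hZ : Z ^t* = Z.
  by rewrite adjmxD adjmxN hX' (adjmx_real_comb s0 hX pQ.1).
suff pZ : psd Z.
  have -> : c0 *+ 2 * q * d = s * q by rewrite /s mulrAC.
  apply: (@psd_le_scalar _ _ _ Q s); rewrite ?pQ.1 //.
  by rewrite addrAC.
apply: (@lyap_comparison _ _ K' Q) => //.
  move=> v v0; rewrite lyapE KQ qformD qformN addrC subr_lt0.
  apply: le_lt_trans (qform_le_norm v (hl _ pQ.1)) _.
  rewrite gtr_pMl ?qform1_gt0 // (le_lt_trans dKQ) //.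
  apply: le_lt_trans kqd; rewrite [leRHS]mulr2n lerDl mulrn_wge0 //.
  by rewrite !mulr_ge0.
pose E := (B' *m B' ^t* - B *m B ^t*) + lyap dK X + s *: lyap dK Q.
have hE : E ^t* = E.
  have hG m (M : 'M[C]_(n, m)) : (M *m M ^t*) ^t* = M *m M ^t* by rewrite adjmxM trmxCK.
  rewrite /E (adjmx_real_comb s0 _ (hl Q pQ.1)) // adjmxD (hl X hX).
  by rewrite adjmxD adjmxN !hG.
have sE : mxnorm1 E <= s.
  have -> : s = (1 + b *+ 2) * d + (k * d * x) *+ 2 + s * 2^-1.
    by rewrite /s /c0; field.
  apply: mxnorm1_leD.
    by apply: mxnorm1_leD; rewrite ?mxnorm1_gram_le.
  rewrite mxnorm1Z ger0_norm // ler_wpM2l // (le_trans dKQ) //.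
  by rewrite -[leRHS]mul1r ler_pdivlMr // mulr_natr ltW.
(* The square produced by the suboptimal gain has the favourable sign whatever [X'] is, so no a
   priori bound on [X'] enters. *)
have -> : - lyap K' Z = (X' *m H' ^t* - L) *m (X' *m H' ^t* - L) ^t* + (s%:M - E).
  rewrite /Z -[- X']scaleN1r !lyapD !lyapZ (lyap_gain L hX' cX') !lyapE KX KQ.
  rewrite GG /E -(scalemx1 _ s); set W := _ *m (_ - L) ^t*.
  by apply/matrixP => i j; rewrite !mx_entryE; ring.
move=> v; rewrite qformD addr_ge0 ?psd_gram // qformD qformN subr_ge0.
by rewrite qform_scalar (le_trans (qform_le_norm v hE)) // ler_wpM2r // qform1_ge0.
Qed.
End CareUpperBound.

(** * Lipschitz bounds for the Riccati solution and the recovered quadruple *)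

Section Recovery.
Variables (C : numClosedFieldType) (n m1 m2 : nat).
Implicit Types (A X : 'M[C]_n) (B : 'M[C]_(n, m1)) (H : 'M[C]_(m2, n)).

Definition riccati_mx A B H X :=
  X *m H ^t* *m H *m X + 'i *: (A *m X - X *m A ^t*) - B *m B ^t*.

Lemma care_riccati A B H X : care (- 'i *: A) B H X = - riccati_mx A B H X.
Proof. by rewrite /care /riccati_mx !adjmxE rmorphN /= conjCi; mxring. Qed.

(** Multiplying by [X^-1] on both sides exchanges the quadratic and the constant terms. *)
Lemma care_riccati_inv A B H X : posdef X -> riccati_mx A B H X = 0 ->
  care (- 'i *: A ^t*) (H ^t*) (B ^t*) (invmx X) = 0.
Proof.
move=> pX rX; have Xu := posdef_unit pX.
have e : invmx X *m riccati_mx A B H X *m invmx X = 0 by rewrite rX mulmx0 mul0mx.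
rewrite -[RHS]e /care /riccati_mx !adjmxE rmorphN /= conjCi opprK; mxexpand.
rewrite mulVmx // !mul1mx -![_ *m X *m invmx X]mulmxA mulmxV // !mulmx1.
by apply/matrixP => i j; rewrite !mx_entryE; ring.
Qed.

Lemma controllable_scale m A (B : 'M[C]_(n, m)) a : a != 0 ->
  controllable A B -> controllable (a *: A) B.
Proof.
move=> a0 AB l v v0 vA; apply: (AB (a^-1 * l) v v0).
by rewrite -scalerA -vA -scalemxAr scalerA mulVf // scale1r.
Qed.

Variables (A : 'M[C]_n) (B : 'M[C]_(n, m1)) (H : 'M[C]_(m2, n)) (X : 'M[C]_n).
Hypothesis pX : posdef X.
Hypothesis rX : riccati_mx A B H X = 0.
Hypothesis AB : controllable A B.
Hypothesis AH : controllable (A ^t*) (H ^t*).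

Lemma riccati_lipschitz : exists c d0 : C, [/\ 0 <= c, 0 < d0 &
  forall d (A' : 'M_n) (B' : 'M_(n, m1)) (H' : 'M_(m2, n)) (X' : 'M_n),
    0 <= d -> d <= d0 ->
    mxnorm1 (A' - A) <= d -> mxnorm1 (B' - B) <= d -> mxnorm1 (H' - H) <= d ->
    posdef X' -> riccati_mx A' B' H' X' = 0 ->
    mxnorm1 (X' - X) <= c * d /\ mxnorm1 (invmx X' - invmx X) <= c * d].
Proof.
have i0 : - 'i != 0 :> C by rewrite oppr_eq0 neq0Ci.
have cX : care (- 'i *: A) B H X = 0 by rewrite care_riccati rX oppr0.
have pY := posdef_inv pX.
have [c1 [d1 [c10 d10 P1]]] := care_upper_bound pX cX (controllable_scale i0 AB).
have [c2 [d2 [c20 d20 P2]]] :=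
  care_upper_bound pY (care_riccati_inv pX rX) (controllable_scale i0 AH).
pose x := mxnorm1 X * mxnorm1 X; pose y := mxnorm1 (invmx X) * mxnorm1 (invmx X).
have x0 : 0 <= x by rewrite mulr_ge0 ?mxnorm1_ge0.
have y0 : 0 <= y by rewrite mulr_ge0 ?mxnorm1_ge0.
(* [c1] and [c2] give the upper bounds for [X'] and its inverse; turning them into lower bounds for
   the other matrix brings in the factors [y] and [x]. [c] dominates all four. *)
pose c := c1 * (1 + y) + c2 * (1 + x).
have c0 : 0 <= c by rewrite addr_ge0 // mulr_ge0 ?addr_ge0.
have i1 (M M' : 'M[C]_n) d : mxnorm1 (M' - M) <= d ->
    mxnorm1 (- 'i *: M' - - 'i *: M) <= d.
  by rewrite -scalerBr mxnorm1Z normrN normCi mul1r.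
have adjB p q (M M' : 'M[C]_(p, q)) d : mxnorm1 (M' - M) <= d ->
    mxnorm1 (M' ^t* - M ^t*) <= d by rewrite -adjmxN -adjmxD mxnorm1_adj.
(* [d1 d2 / (d1 + d2)] lies below both thresholds and replaces a minimum, the order of [C] being
   partial. *)
exists (c *+ (3 * (n * n))), (d1 * d2 / (d1 + d2)); split.
- by rewrite mulrn_wge0.
- by rewrite divr_gt0 ?mulr_gt0 ?addr_gt0.
move=> d A' B' H' X' d0 dd dA dB dH pX' rX'.
have dd1 : d <= d1.
  rewrite (le_trans dd) // ler_pdivrMr ?addr_gt0 // ler_wpM2l ?(ltW d10) //.
  by rewrite lerDr ltW.
have dd2 : d <= d2.
  rewrite (le_trans dd) // ler_pdivrMr ?addr_gt0 // mulrC ler_wpM2l ?(ltW d20) //.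
  by rewrite lerDl ltW.
have pY' := posdef_inv pX'.
have cX' : care (- 'i *: A') B' H' X' = 0 by rewrite care_riccati rX' oppr0.
have X_up := P1 d _ _ _ X' d0 dd1 (i1 _ _ _ dA) dB dH pX'.1 cX'.
have Y_up := P2 d _ _ _ (invmx X') d0 dd2 (i1 _ _ _ (adjB _ _ _ _ _ dA))
  (adjB _ _ _ _ _ dH) (adjB _ _ _ _ _ dB) pY'.1 (care_riccati_inv pX' rX').
have cd1 : 0 <= c1 * d by rewrite mulr_ge0.
have cd2 : 0 <= c2 * d by rewrite mulr_ge0.
have X_lo := psd_inv_lower pX pX' cd2 Y_up.
have Y_lo : psd (invmx X' - invmx X + (c1 * d * y)%:M).
  by apply: psd_inv_lower; rewrite // !invmxK.
have cd : 0 <= c * d by rewrite mulr_ge0.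
have cE : c * d = c1 * d + c1 * d * y + c2 * d + c2 * d * x by rewrite /c; ring.
have cdy : 0 <= c1 * d * y by rewrite mulr_ge0.
have cdx : 0 <= c2 * d * x by rewrite mulr_ge0.
have swap (P Q : 'M[C]_n) : psd (P - Q + (c * d)%:M) -> psd ((c * d)%:M - (Q - P)).
  by rewrite opprB addrC.
rewrite !mulrnAl; split; apply: mxnorm1_le_psd => //.
- by rewrite adjmxD adjmxN pX.1 pX'.1.
- by apply: psd_mono_scalar X_lo; rewrite cE lerDr !addr_ge0.
- by apply/swap/(psd_mono_scalar _ X_up); rewrite cE -!addrA lerDl !addr_ge0.
- by rewrite adjmxD adjmxN pY.1 pY'.1.
- apply: psd_mono_scalar Y_lo.
  by rewrite cE addrAC [_ + c1 * d * y]addrC -!addrA lerDl !addr_ge0.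
- by apply/swap/(psd_mono_scalar _ Y_up); rewrite cE [_ + c2 * d]addrC -!addrA lerDl !addr_ge0.
Qed.

Lemma recovery_lipschitz : exists c d0 : C, [/\ 0 <= c, 0 < d0 &
  forall d (A' : 'M_n) (B' : 'M_(n, m1)) (H' : 'M_(m2, n)) (X' : 'M_n),
    0 <= d -> d <= d0 ->
    mxnorm1 (A - A') <= d -> mxnorm1 (B - B') <= d -> mxnorm1 (H - H') <= d ->
    posdef X' -> riccati_mx A' B' H' X' = 0 ->
    mxnorm1 ((A + 'i *: (B *m B ^t* *m invmx X)) -
             (A' + 'i *: (B' *m B' ^t* *m invmx X'))) +
    mxnorm1 (X - X') + mxnorm1 (B - B') +
    mxnorm1 ('i *: (X *m H ^t*) - 'i *: (X' *m H' ^t*)) <= c * d].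
Proof.
have [c [d1 [c0 d10 P]]] := riccati_lipschitz.
pose b := mxnorm1 B; pose x := mxnorm1 X; pose y := mxnorm1 (invmx X).
pose h := mxnorm1 H.
have b0 : 0 <= b by exact: mxnorm1_ge0.
have x0 : 0 <= x by exact: mxnorm1_ge0.
have y0 : 0 <= y by exact: mxnorm1_ge0.
have h0 : 0 <= h by exact: mxnorm1_ge0.
(* The summands bound, in order, the errors in [alpha], [S0], [theta1] and [theta2]. The threshold
   is below both [1] and [d1]; [d <= 1] keeps the perturbed factors bounded. *)
exists (1 + ((1 + b *+ 2) * (y + c) + b * b * c) + c + 1 + (c * (h + 1) + x)),
  (d1 / (1 + d1)); split.
- by rewrite !addr_ge0 // ?mulr_ge0 ?addr_ge0 ?mulrn_wge0 ?mulr_ge0.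
- by rewrite divr_gt0 ?addr_gt0.
move=> d A' B' H' X' d0 dd.
have d_le1 : d <= 1.
  by rewrite (le_trans dd) // ler_pdivrMr ?addr_gt0 // mul1r lerDr.
have d_led1 : d <= d1.
  by rewrite (le_trans dd) // ler_pdivrMr ?addr_gt0 // ler_peMr ?(ltW d10) // lerDl ltW.
have sym p q (M M' : 'M[C]_(p, q)) : mxnorm1 (M - M') = mxnorm1 (M' - M).
  by rewrite -mxnorm1N opprB.
rewrite (sym _ _ A) (sym _ _ B) (sym _ _ H).
move=> dA dB dH pX' rX'.
have [dX dY] := P d A' B' H' X' d0 d_led1 dA dB dH pX' rX'.
have cd1 : c * d <= c by rewrite ler_piMr.
have E1 : mxnorm1 (A' + 'i *: (B' *m B' ^t* *m invmx X') -
    (A + 'i *: (B *m B ^t* *m invmx X))) <=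
    (1 + ((1 + b *+ 2) * (y + c) + b * b * c)) * d.
  have -> : A' + 'i *: (B' *m B' ^t* *m invmx X') -
     (A + 'i *: (B *m B ^t* *m invmx X)) = (A' - A) +
     'i *: ((B' *m B' ^t* - B *m B ^t*) *m invmx X' +
            B *m B ^t* *m (invmx X' - invmx X)) by mxring.
  rewrite mulrDl mul1r mxnorm1_leD // mxnorm1Z normCi mul1r mulrDl mxnorm1_leD //.
    rewrite mulrAC mxnorm1_leM ?mxnorm1_gram_le //.
    by rewrite -[invmx X'](subrK (invmx X)) addrC mxnorm1_leD // (le_trans dY).
  by rewrite -mulrA mxnorm1_leM // mxnorm1_leM ?mxnorm1_adj.
have E2 : mxnorm1 ('i *: (X' *m H' ^t*) - 'i *: (X *m H ^t*)) <=
    (c * (h + 1) + x) * d.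
  have -> : 'i *: (X' *m H' ^t*) - 'i *: (X *m H ^t*) =
      'i *: ((X' - X) *m H' ^t* + X *m (H' - H) ^t*) by rewrite !adjmxE; mxring.
  rewrite mxnorm1Z normCi mul1r mulrDl mxnorm1_leD //.
    rewrite mulrAC mxnorm1_leM // mxnorm1_adj -[H'](subrK H) addrC mxnorm1_leD //.
    exact: le_trans dH _.
  by rewrite mxnorm1_leM ?mxnorm1_adj.
rewrite (sym _ _ (A + _)) (sym _ _ X) (sym _ _ (_ *: (X *m _))).
rewrite mulrDl [_ * d]mulrDl [_ * d]mulrDl mul1r; do 3?apply: lerD => //.
Qed.
End Recovery.

(** * From minimality to controllability and observability *)

Lemma invmx_intertwine (F : comUnitRingType) n k (S : 'M[F]_n) (T : 'M_k)
    (P : 'M_(n, k)) : S *m P = P *m T -> S \in unitmx -> T \in unitmx ->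
  invmx S *m P = P *m invmx T.
Proof.
move=> e Su Tu; rewrite -[LHS](mulmxK Tu) -[_ *m P *m T]mulmxA -e.
by rewrite mulmxA mulVmx // mul1mx.
Qed.

Section Realizations.
Variable R : realType.
Local Notation toP := (map_mx (@polyC R[i])).
Local Notation toF := (map_mx (@FracField.tofrac {poly R[i]})).

Lemma transferE n m1 m2 (A : 'M[R[i]]_n) (B : 'M[R[i]]_(n, m1)) (C : 'M[R[i]]_(m2, n)) :
  transfer A B C = toF (toP C) *m invmx (toF (char_poly_mx A)) *m toF (toP B).
Proof. by rewrite /transfer -!map_mx_comp. Qed.

Lemma resolvent_unit n (A : 'M[R[i]]_n) : toF (char_poly_mx A) \in unitmx.
Proof.
by rewrite unitmxE det_map_mx unitfE tofrac_eq0 monic_neq0 ?char_poly_monic.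
Qed.

(** The relation [(z - A) P = P (z - A')] passes to the inverses. For [P] a basis of an invariant
    subspace, this restricts a realization to that subspace. *)
Lemma transfer_intertwine n k m1 m2 (A : 'M[R[i]]_n) (A' : 'M[R[i]]_k)
    (P : 'M[R[i]]_(n, k)) (B : 'M[R[i]]_(k, m1)) (C : 'M[R[i]]_(m2, n)) :
  A *m P = P *m A' -> transfer A (P *m B) C = transfer A' B (C *m P).
Proof.
move=> AP; rewrite !transferE !map_mxM.
have e : toF (char_poly_mx A) *m toF (toP P) = toF (toP P) *m toF (char_poly_mx A').
  by rewrite -!map_mxM /char_poly_mx mulmxBl mulmxBr -!map_mxM AP scalar_mxC.
rewrite !mulmxA; congr (_ *m _); rewrite -!mulmxA; congr (_ *m _).
exact: invmx_intertwine e (resolvent_unit A) (resolvent_unit A').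
Qed.

Lemma transfer_tr n m1 m2 (A : 'M[R[i]]_n) (B : 'M[R[i]]_(n, m1)) (C : 'M[R[i]]_(m2, n)) :
  (transfer A B C)^T = transfer A^T C^T B^T.
Proof.
have e : (toF (char_poly_mx A))^T = toF (char_poly_mx A^T).
  by rewrite map_trmx /char_poly_mx linearB /= tr_scalar_mx map_trmx.
rewrite !transferE trmx_mul trmx_mul trmx_inv e mulmxA.
by rewrite !map_trmx.
Qed.

Lemma minimal_realization_tr n m1 m2 (phi : 'M[ratfun R]_(m2, m1))
    (A : 'M[R[i]]_n) (B : 'M[R[i]]_(n, m1)) (C : 'M[R[i]]_(m2, n)) :
  minimal_realization phi A B C -> minimal_realization phi^T A^T C^T B^T.
Proof.
move=> [phiE phi_min]; split; first by rewrite phiE transfer_tr.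
move=> k A' B' C' E; apply: (phi_min k A'^T C'^T B'^T).
by rewrite -transfer_tr -E trmxK.
Qed.

(* If [v] is a left eigenvector of [A] annihilating [B], the realization
   restricts to the [A]-invariant hyperplane [{x | v x = 0}]. *)
Lemma minimal_controllable n m1 m2 (phi : 'M[ratfun R]_(m2, m1))
    (A : 'M[R[i]]_n) (B : 'M[R[i]]_(n, m1)) (C : 'M[R[i]]_(m2, n)) :
  minimal_realization phi A B C -> controllable A B.
Proof.
move=> [phiE phi_min] l v v0 vA vB.
(* The columns of [P] form a basis of the hyperplane [v x = 0], so matrices annihilated by [v]
   factor through [P]. *)
pose P := (row_base (kermx v^T))^T.
have factor k (M : 'M[R[i]]_(n, k)) : v *m M = 0 -> exists D, M = P *m D.
  move=> vM; have : (M^T <= row_base (kermx v^T))%MS.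
    by rewrite eq_row_base; apply/sub_kermxP; rewrite -trmx_mul vM trmx0.
  by move=> /submxP [D DE]; exists D^T; rewrite -[M]trmxK DE trmx_mul.
have vP : v *m P = 0.
  apply: trmx_inj; rewrite trmx_mul trmxK trmx0; apply/sub_kermxP.
  by rewrite eq_row_base.
have [A' AE] : exists A', A *m P = P *m A'.
  by apply: factor; rewrite mulmxA vA -scalemxAl vP scaler0.
have [B' BE] := factor _ _ vB.
have := phi_min _ A' B' (C *m P); rewrite -(transfer_intertwine _ _ AE) -BE => /(_ phiE).
(* The restricted realization has size [n - 1]; with truncated subtraction, [n <= n - 1] is absurd
   only once [n] is known to be positive. *)
rewrite mxrank_ker mxrank_tr rank_rV v0 => h.
have n_gt0 : (0 < n)%N.
  rewrite lt0n; apply: contra v0 => /eqP n0; apply/eqP/rowP => i.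
  by move: (ltn_ord i); rewrite [X in (_ < X)%N]n0.
by move: h; rewrite leqNgt subn1 ltn_predL n_gt0.
Qed.

(** Transposition preserves minimality, and entrywise conjugation carries eigenvectors of [A^*] to
    eigenvectors of [A^T]. *)
Lemma minimal_observable n m1 m2 (phi : 'M[ratfun R]_(m2, m1))
    (A : 'M[R[i]]_n) (B : 'M[R[i]]_(n, m1)) (C : 'M[R[i]]_(m2, n)) :
  minimal_realization phi A B C -> controllable (A ^t*) (C ^t*).
Proof.
move=> /minimal_realization_tr/minimal_controllable h l v v0 vA vC.
have conjK p q (M : 'M[R[i]]_(p, q)) : map_mx Num.conj (map_mx Num.conj M) = M.
  by apply/matrixP => i j; rewrite !mxE conjCK.
apply: (h (l^*) (map_mx Num.conj v)).
- by apply: contra v0 => /eqP e; rewrite -[v]conjK e map_mx0.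
- by rewrite -[A^T]conjK -map_mxM vA map_mxZ.
by rewrite -[C^T]conjK -map_mxM vC map_mx0.
Qed.
End Realizations.

Local Open Scope complex_scope.

(** * Comparison of the operator norm with the entrywise norm *)

Section OperatorNorm.
Variable R : realType.
Local Notation normc := (@Normc.normc R).

Lemma normcC (x : R[i]) : `|x| = (normc x)%:C.
Proof. by rewrite normc_def; case: x. Qed.

Lemma normc_ge0 (x : R[i]) : 0 <= normc x.
Proof. by case: x => a b; apply: sqrtr_ge0. Qed.

Lemma normc_le_l2norm n (x : 'cV[R[i]]_n) k : normc (x k 0) <= l2norm x.
Proof.
rewrite -[leLHS]ger0_norm ?normc_ge0 // -sqrtr_sqr ler_wsqrtr //.
by rewrite (bigD1 k) //= lerDl sumr_ge0 // => i _; rewrite sqr_ge0.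
Qed.

Lemma l2norm_le_sum n (x : 'cV[R[i]]_n) : l2norm x <= \sum_k normc (x k 0).
Proof.
have s0 : 0 <= \sum_k normc (x k 0) by apply: sumr_ge0 => k _; apply: normc_ge0.
rewrite -[leRHS]ger0_norm // -sqrtr_sqr ler_wsqrtr // [leRHS]expr2 mulr_suml.
rewrite ler_sum // => k _; rewrite expr2 ler_wpM2l ?normc_ge0 //.
by rewrite (bigD1 k) //= lerDl sumr_ge0 // => i _; apply: normc_ge0.
Qed.

Lemma mxnorm1C m n (M : 'M[R[i]]_(m, n)) :
  mxnorm1 M = (\sum_i \sum_j normc (M i j))%:C.
Proof.
rewrite raddf_sum; apply: eq_bigr => i _; rewrite raddf_sum.
by apply: eq_bigr => j _; apply: normcC.
Qed.

Lemma l2norm_mul_le m n (M : 'M[R[i]]_(m, n)) (x : 'cV[R[i]]_n) :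
  l2norm x <= 1 -> l2norm (M *m x) <= \sum_i \sum_j normc (M i j).
Proof.
move=> x1; apply: le_trans (l2norm_le_sum _) _; apply: ler_sum => i _.
rewrite -lecR -normcC mxE (le_trans (ler_norm_sum _ _ _)) // raddf_sum.
rewrite ler_sum // => j _; rewrite normrM !normcC -rmorphM lecR.
by rewrite ler_piMr ?normc_ge0 // (le_trans (normc_le_l2norm _ _)).
Qed.

Lemma l2norm0 n : l2norm (0 : 'cV[R[i]]_n) = 0.
Proof.
apply/eqP; rewrite eq_le sqrtr_ge0 andbT (le_trans (l2norm_le_sum _)) //.
by rewrite big1 // => k _; rewrite mxE Normc.normc0.
Qed.

Lemma opnorm_le m n (M : 'M[R[i]]_(m, n)) :
  opnorm M <= \sum_i \sum_j normc (M i j).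
Proof.
apply: ge_sup; first by exists (l2norm (M *m 0)), 0 => //=; rewrite l2norm0.
by move=> _ [x /= x1 <-]; apply: l2norm_mul_le.
Qed.

Lemma entry_le_opnorm m n (M : 'M[R[i]]_(m, n)) i j : normc (M i j) <= opnorm M.
Proof.
apply: le_trans (_ : l2norm (M *m delta_mx j 0) <= _).
  by have := normc_le_l2norm (M *m delta_mx j 0) i; rewrite -colE mxE.
(* Comparing a member with [sup] requires the set to be bounded; the sum of the moduli of the
   entries is a bound. *)
apply: ub_le_sup.
  exists (\sum_i \sum_j normc (M i j)) => _ [x /= x1 <-].
  exact: l2norm_mul_le.
exists (delta_mx j 0) => //=; apply: le_trans (l2norm_le_sum _) _.
rewrite (bigD1 j) //= big1 => [|k /negPf kj].
  by rewrite mxE !eqxx Normc.normc1 addr0.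
by rewrite mxE kj Normc.normc0.
Qed.

Lemma opnorm_le_mxnorm1 m n (M : 'M[R[i]]_(m, n)) : (opnorm M)%:C <= mxnorm1 M.
Proof. by rewrite mxnorm1C lecR opnorm_le. Qed.

Lemma opnorm_ge0 m n (M : 'M[R[i]]_(m, n)) : 0 <= opnorm M.
Proof.
apply: ub_le_sup.
  exists (\sum_i \sum_j normc (M i j)) => _ [x /= x1 <-].
  exact: l2norm_mul_le.
by exists 0; rewrite /= ?mulmx0 l2norm0.
Qed.

Lemma mxnorm1_le_opnorm m n (M : 'M[R[i]]_(m, n)) :
  mxnorm1 M <= (opnorm M *+ (m * n))%:C.
Proof.
rewrite rmorphMn; apply: mxnorm1_le => i j.
by rewrite normcC lecR entry_le_opnorm.
Qed.
End OperatorNorm.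

(** * Stability of the recovery *)

(** In a spectral decomposition the rows of [P] are left eigenvectors, so the form is a sum of
    squares with positive weights, in coordinates that do not all vanish. *)
Lemma posdefmx_posdef (R : realType) n (X : 'M[R[i]]_n) : posdefmx X -> posdef X.
Proof.
move=> [/hermsymmxP hX X0]; split=> // v v0.
have [P [d [Pu dr XE]]] := hermitian_spectral hX.
have d0 i : 0 < d 0 i.
  apply: X0; apply/eigenvalueP; exists (row i P); last exact: unitary_row_neq0.
  rewrite XE -row_mul !mulmxA (unitarymxP Pu) mul1mx row_mul.
  by rewrite row_diag_mx -scalemxAl -rowE.
have u0 : v *m P ^t* != 0.
  apply: contra v0 => /eqP h; rewrite -[v](mulmxtVK _ (_ : P ^t* \is unitarymx)) ?trmxC_unitary //.
  by rewrite h mul0mx.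
have s0 i : 0 <= d 0 i * `|(v *m P ^t*) 0 i| ^+ 2.
  by rewrite mulr_ge0 ?exprn_ge0 // ltW.
rewrite XE qform_congr qform_diag lt_def sumr_ge0 // andbT psumr_eq0 //.
apply: contra u0 => /allP h; apply/eqP/rowP => i; have := h i (mem_index_enum _).
rewrite implyTb mulf_eq0 (gt_eqF (d0 i)) sqrf_eq0 normr_eq0 orFb.
by move=> /eqP ->; rewrite mxE.
Qed.

Theorem corollary3p4 (R : realType) (n m1 m2 : nat)
  (phi : 'M[ratfun R]_(m2, m1))
  (A : 'M[R[i]]_n) (B : 'M[R[i]]_(n, m1)) (C : 'M[R[i]]_(m2, n))
  (alpha S0 : 'M[R[i]]_n) (theta1 : 'M[R[i]]_(n, m1))
  (theta2 : 'M[R[i]]_(n, m2))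
  (phi_sp : strictly_proper phi)
  (phi_min : minimal_realization phi A B C)
  (rec : recovered A B C alpha S0 theta1 theta2) :
  forall eps : R, 0 < eps ->
  exists2 delta : R, 0 < delta &
  forall (phi' : 'M[ratfun R]_(m2, m1))
    (A' : 'M[R[i]]_n) (B' : 'M[R[i]]_(n, m1)) (C' : 'M[R[i]]_(m2, n))
    (alpha' S0' : 'M[R[i]]_n) (theta1' : 'M[R[i]]_(n, m1))
    (theta2' : 'M[R[i]]_(n, m2)),
    minimal_realization phi' A' B' C' ->
    recovered A' B' C' alpha' S0' theta1' theta2' ->
    opnorm (A - A') + opnorm (B - B') + opnorm (C - C') < delta ->
    opnorm (alpha - alpha') + opnorm (S0 - S0')
      + opnorm (theta1 - theta1') + opnorm (theta2 - theta2') < eps.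
Proof.
case: rec => X [[/posdefmx_posdef pX rX] -> -> -> ->] eps eps0.
have [c [d0 [c_ge0 d0_gt0 lip]]] := recovery_lipschitz pX rX
  (minimal_controllable phi_min) (minimal_observable phi_min).
(* Nonnegative elements of [R[i]] are real, so both constants come from [R]. *)
have cE : c = (complex.Re c)%:C by rewrite RRe_real // ger0_real.
have dE : d0 = (complex.Re d0)%:C by rewrite RRe_real // gtr0_real.
set cr := complex.Re c in cE; set dr := complex.Re d0 in dE.
rewrite {}cE {}dE in c_ge0 d0_gt0 lip.
have cr0 : 0 <= cr by rewrite -lecR.
have dr0 : 0 < dr by rewrite -ltcR.
(* [k] bounds the number of entries of each of the three matrices, the cost of passing from [opnorm]
   to [mxnorm1]. The successor of [k] and [1 + cr] keep the denominators positive. *)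
pose k := (n * n + n * m1 + m2 * n)%N.
pose m := Num.min dr (eps / (1 + cr)).
have m0 : 0 < m by rewrite lt_min dr0 divr_gt0 // ltr_wpDr.
exists (m / k.+1%:R); first by rewrite divr_gt0.
move=> _ A' B' C' _ _ _ _ _ [X' [[/posdefmx_posdef pX' rX'] -> -> -> ->]] small.
have bound p q (M : 'M[R[i]]_(p, q)) : (p * q <= k)%N ->
    opnorm M <= opnorm (A - A') + opnorm (B - B') + opnorm (C - C') ->
    mxnorm1 M <= m%:C.
  move=> pq hM; apply: le_trans (mxnorm1_le_opnorm M) _; rewrite lecR.
  have := le_lt_trans hM small; rewrite ltr_pdivlMr // mulr_natr => /ltW.
  apply: le_trans; apply: ler_wpMn2l; first exact: opnorm_ge0.
  exact: leq_trans pq _.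
have m_ge0 : 0 <= m%:C by rewrite lecR ltW.
have m_le : m%:C <= dr%:C by rewrite lecR ge_min lexx.
have h1 := opnorm_ge0 (A - A'); have h2 := opnorm_ge0 (B - B').
have h3 := opnorm_ge0 (C - C').
have dA : mxnorm1 (A - A') <= m%:C.
  by apply: bound; rewrite /k -?addnA ?leq_addr // -addrA lerDl addr_ge0.
have dB : mxnorm1 (B - B') <= m%:C.
  by apply: bound; rewrite /k 1?addnAC ?leq_addl // addrAC lerDr addr_ge0.
have dC : mxnorm1 (C - C') <= m%:C.
  by apply: bound; rewrite /k ?leq_addl // lerDr addr_ge0.
have H := lip _ _ _ _ _ m_ge0 m_le dA dB dC pX' rX'.
rewrite -ltcR !rmorphD /=; apply: le_lt_trans (_ : _ <= cr%:C * m%:C) _.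
  by apply: le_trans H; rewrite !lerD ?opnorm_le_mxnorm1.
rewrite -rmorphM ltcR; apply: le_lt_trans (_ : _ <= cr * (eps / (1 + cr))) _.
  by rewrite ler_wpM2l // ge_min lexx orbT.
by rewrite mulrCA gtr_pMr // ltr_pdivrMr ?ltr_wpDr // mul1r ltrDr.
Qed.
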